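(* Let the array $\mathcal A$ be a disk of radius $a$, and consider a single dipole at $\vec y_*=(y_*,L+\eta_* )$ with polarization vector $\vec p_*\in\mathbb C^3$, $\|\vec p_*\|=\mathcal O(1)$. Assume the Fraunhofer regime holds uniformly over the frequency band $[\omega_0-B/2,\omega_0+B/2]$. Then the multi-frequency Kirchhoff imaging function $\vec{\mathcal I}_{\mathrm{KM}}(\vec y)$ satisfies, for all $\vec y=(y_*,L+\eta)$ with $\eta\ne\eta_*$, $$\|\vec{\mathcal I}_{\mathrm{KM}}(\vec y)\|=B\,\frac{a^2}{L^2}\left(\mathcal O\Big(\frac{c}{B\,|\eta-\eta_*|}\Big)+o(1)\right),$$ and at the dipole location $$\vec{\mathcal I}_{\mathrm{KM}}(\vec y_* )=B\left[\frac{a^2}{16\pi L^2}\begin{pmatrix}1&0&0\\0&1&0\\0&0&0\end{pmatrix}\vec p_*+o\Big(\frac{a^2}{L^2}\Big)\right].$$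
   Context: Notation. Points of $\mathbb R^3$ are written $\vec x=(x,z)$ with $x\in\mathbb R^2$ the cross-range part and $z$ the range part. $c>0$ is the wave speed, $\mu>0$ the magnetic permeability, $\omega>0$ the angular frequency, $k=\omega/c$. With $\vec r=\vec x-\vec y$, $r=\|\vec r\|$, $m(kr)=(\mathrm i kr-1)/(kr)^2$, and $G(\vec x,\vec y;k)=\frac{e^{\mathrm i k\|\vec x-\vec y\|}}{4\pi\|\vec x-\vec y\|}$, the dyadic Green function is the $3\times3$ matrix $$\mathbb G(\vec x,\vec y;k)=G(\vec x,\vec y;k)\Big[(1+m(kr))\mathbb I-(1+3m(kr))\frac{\vec r\,\vec r^{\top}}{r^2}\Big].$$ Array, data, image. $\mathcal A=\{x_r\in\mathbb R^2:\|x_r\|\le a\}$, receivers are $\vec x_r=(x_r,0)$, $x_r\in\mathcal A$. The data are $\vec\Pi(x_r;k)=\mu\omega^2\,\mathbb G(\vec x_r,\vec y_*;k)\vec p_*$, the single-frequency Kirchhoff imaging function is $$\vec{\mathcal I}_{\mathrm{KM}}(\vec y;k)=(\mu\omega^2)^{-1}\int_{\mathcal A}\overline{\mathbb G(\vec x_r,\vec y;k)}\,\vec\Pi(x_r;k)\,\mathrm dx_r,$$ and the multi-frequency one, over the band with central frequency $\omega_0$ and bandwidth $B$, is $$\vec{\mathcal I}_{\mathrm{KM}}(\vec y)=\int_{|\omega-\omega_0|<B/2}\vec{\mathcal I}_{\mathrm{KM}}\Big(\vec y;\frac{\omega}{c}\Big)\,\mathrm d\omega .$$ Fraunhofer regime.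 Imaging points and the dipole position lie in the imaging window: they are of the form $(y,L+\eta)$ with $\|y\|=\mathcal O(b)$ and $|\eta|=\mathcal O(h)$. Put $\Theta_a=ka^2/L$, $\Theta_b=kb^2/L$, $\Theta_h=kh^2/L$. The parameters vary so that $kL\gg1$, $a\ll L$, $b\ll L$, $h\ll L$, $\Theta_b\ll1$, $1\ll\Theta_a\ll L^2/a^2$ and $kh=\mathcal O(1)$, where $X\ll Y$ means $X/Y\to0$, all of this uniformly for $k=\omega/c$ with $\omega\in[\omega_0-B/2,\omega_0+B/2]$. The symbols $\mathcal O$, $o$ refer to this limit, uniformly over points of the imaging window. *)

(* Defs.v *)
From HB Require Import structures.
From mathcomp Require Import all_boot all_order all_algebra.
From mathcomp Require Import complex.
From mathcomp Require Import all_classical all_reals all_analysis.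
Set Implicit Arguments.
Unset Strict Implicit.
Unset Printing Implicit Defensive.
Import Order.TTheory GRing.Theory Num.Theory.
Import numFieldNormedType.Exports.
Local Open Scope classical_set_scope.
Local Open Scope ring_scope.
Local Open Scope complex_scope.

Section Vectors.
Context {R : realType}.

(* The norm `|_| that the library puts on R * R and on matrices is the sup
   norm, hence the explicit Euclidean and Hermitian norms. *)
Definition norm2 (x : R * R) : R := Num.sqrt (x.1 ^+ 2 + x.2 ^+ 2).

Definition enorm n (v : 'cV[R]_n) : R := Num.sqrt (\sum_i v i 0 ^+ 2).

Definition cnorm n (v : 'cV[R[i]]_n) : R :=
  Num.sqrt (\sum_i (complex.Re (v i 0) ^+ 2 + complex.Im (v i 0) ^+ 2)).

Definition point3 (x : R * R) (z : R) : 'cV[R]_3 :=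
  \col_(i < 3) [:: x.1; x.2; z]`_i.

Definition expi (t : R) : R[i] := cos t +i* sin t.

Definition mx_toC m n (M : 'M[R]_(m, n)) : 'M[R[i]]_(m, n) :=
  map_mx (fun x : R => x%:C) M.

Definition mx_conj m n (M : 'M[R[i]]_(m, n)) : 'M[R[i]]_(m, n) :=
  map_mx (fun z : R[i] => z^*) M.

End Vectors.

Definition cVintegral d (T : measurableType d) (R : realType)
    (mu : {measure set T -> \bar R}) n (D : set T) (f : T -> 'cV[R[i]]_n) :
    'cV[R[i]]_n :=
  \col_(i < n) ((\int[mu]_(x in D) complex.Re (f x i 0)) +i*
                (\int[mu]_(x in D) complex.Im (f x i 0))).

Section Imaging.
Context {R : realType}.

Definition green (x y : 'cV[R]_3) (k : R) : R[i] :=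
  expi (k * enorm (x - y)) / (4 * pi * enorm (x - y))%:C.

Definition dyadic_m (s : R) : R[i] := ('i%C * s%:C - 1) / (s ^+ 2)%:C.

Definition dyadic_green (x y : 'cV[R]_3) (k : R) : 'M[R[i]]_3 :=
  let r := enorm (x - y) in
  let m := dyadic_m (k * r) in
  green x y k *: ((1 + m) *: 1%:M -
    (1 + 3 * m) *: mx_toC ((r ^+ 2)^-1 *: ((x - y) *m (x - y)^T))).

Record params := Params {
  wspeed : R;     (* c *)
  permea : R;     (* mu *)
  cfreq : R;      (* omega_0, an angular frequency *)
  bandw : R;      (* B *)
  arrayr : R;     (* a *)
  standoff : R;      (* L *)
  winx : R;       (* b, cross-range scale of the imaging window *)
  winz : R        (* h, range scale of the imaging window *)
}.

Record dipole := Dipole {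
  crossr : R * R;       (* y_star *)
  roffset : R;          (* eta_star, offset from the standoff L *)
  polar : 'cV[R[i]]_3   (* p_star *)
}.

Definition wavenumber (P : params) (w : R) : R := w / wspeed P.

Definition receivers (P : params) : set (R * R) :=
  [set x | norm2 x <= arrayr P].

Definition dipole_point (P : params) (q : dipole) : 'cV[R]_3 :=
  point3 (crossr q) (standoff P + roffset q).

Definition array_data (P : params) (q : dipole) (w : R) (xr : R * R) :
    'cV[R[i]]_3 :=
  (permea P * w ^+ 2)%:C *:
    (dyadic_green (point3 xr 0) (dipole_point P q) (wavenumber P w)
       *m polar q).

Definition KM_freq (P : params) (q : dipole) (y : 'cV[R]_3) (w : R) :
    'cV[R[i]]_3 :=
  ((permea P * w ^+ 2)^-1)%:C *:
    cVintegral (@lebesgue_measure R \x @lebesgue_measure R)%E (receivers P)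
      (fun xr => mx_conj (dyadic_green (point3 xr 0) y (wavenumber P w))
                   *m array_data P q w xr).

Definition KM (P : params) (q : dipole) (y : 'cV[R]_3) : 'cV[R[i]]_3 :=
  cVintegral (@lebesgue_measure R)
    [set w | `|w - cfreq P| < bandw P / 2] (KM_freq P q y).

End Imaging.
Arguments params : clear implicits.
Arguments dipole : clear implicits.

(* Landau symbols along a filter F on the set T of parameter indices, uniform
   in a variable u ranging over a set S t that may depend on the parameters. *)
Section UniformLandau.
Context {R : realType} {T U : Type}.
Variables (F : set_system T) (S : T -> set U).

Definition unif_bigO (f g : T -> U -> R) : Prop :=
  exists M : R, \forall t \near F, forall u, S t u ->
    `|f t u| <= M * `|g t u|.

Definition unif_littleo (f g : T -> U -> R) : Prop :=
  forall e : R, 0 < e -> \forall t \near F, forall u, S t u ->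
    `|f t u| <= e * `|g t u|.

(* X / Y tends to 0; Y is nonzero wherever this is used, so that the convention
   _ / 0 = 0 plays no role *)
Definition unif_ll (X Y : T -> U -> R) : Prop :=
  unif_littleo (fun t u => X t u / Y t u) (fun _ _ => 1).

End UniformLandau.

Section Regime.
Context {R : realType} {T : Type}.

Definition closed_band (P : params R) : set R :=
  [set w | cfreq P - bandw P / 2 <= w <= cfreq P + bandw P / 2].

Record admissible (P : params R) : Prop := Admissible {
  wspeed_gt0 : 0 < wspeed P;
  permea_gt0 : 0 < permea P;
  band_gt0 : forall w, closed_band P w -> 0 < w;
  bandw_gt0 : 0 < bandw P;
  arrayr_gt0 : 0 < arrayr P;
  standoff_gt0 : 0 < standoff P;
  winx_gt0 : 0 < winx P;
  winz_gt0 : 0 < winz P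
}.

Definition Theta (P : params R) (l w : R) : R :=
  wavenumber P w * l ^+ 2 / standoff P.

Record fraunhofer (F : set_system T) (P : T -> params R) : Prop := Fraunhofer {
  fraunhofer_adm : forall t, admissible (P t);
  fraunhofer_kL : unif_ll F (closed_band \o P)
    (fun _ _ => 1) (fun t w => wavenumber (P t) w * standoff (P t));
  fraunhofer_a : unif_ll F (closed_band \o P)
    (fun t _ => arrayr (P t)) (fun t _ => standoff (P t));
  fraunhofer_b : unif_ll F (closed_band \o P)
    (fun t _ => winx (P t)) (fun t _ => standoff (P t));
  fraunhofer_h : unif_ll F (closed_band \o P)
    (fun t _ => winz (P t)) (fun t _ => standoff (P t));
  fraunhofer_Thetab : unif_ll F (closed_band \o P)
    (fun t w => Theta (P t) (winx (P t)) w) (fun _ _ => 1);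
  fraunhofer_Thetaa : unif_ll F (closed_band \o P)
    (fun _ _ => 1) (fun t w => Theta (P t) (arrayr (P t)) w);
  fraunhofer_Thetaa_sup : unif_ll F (closed_band \o P)
    (fun t w => Theta (P t) (arrayr (P t)) w)
    (fun t _ => standoff (P t) ^+ 2 / arrayr (P t) ^+ 2);
  fraunhofer_kh : unif_bigO F (closed_band \o P)
    (fun t w => wavenumber (P t) w * winz (P t)) (fun _ _ => 1)
}.

(* Dipoles in the imaging window: Cb, Ch and Cp are the constants implied in
   ||y_star|| = O(b), |eta_star| = O(h) and ||p_star|| = O(1). *)
Definition window_dipole (Cb Ch Cp : R) (P : params R) : set (dipole R) :=
  [set q | [/\ norm2 (crossr q) <= Cb * winx P,
               `|roffset q| <= Ch * winz P & cnorm (polar q) <= Cp]].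

Definition window_offset (Cb Ch Cp : R) (P : params R) : set (dipole R * R) :=
  [set u | [/\ window_dipole Cb Ch Cp P u.1,
               `|u.2| <= Ch * winz P & u.2 != roffset u.1]].

Definition cross_proj : 'M[R[i]]_3 :=
  \matrix_(i < 3, j < 3) ((i == j) && (i < 2)%N)%:R.

End Regime.

(* Main.v *)
Require Import Defs.
From HB Require Import structures.
From mathcomp Require Import all_boot all_order all_algebra.
From mathcomp Require Import complex.
From mathcomp Require Import all_classical all_reals all_analysis.
From mathcomp Require Import measurable_realfun ring lra.
Import Order.TTheory GRing.Theory Num.Theory.
Import numFieldNormedType.Exports.
Local Open Scope classical_set_scope.
Local Open Scope ring_scope.
Local Open Scope complex_scope.

(* In the Fraunhofer regime the product of dyadic kernels conj(G(x_r, y))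
   G(x_r, y_star) is, uniformly over the array, the window and the band, within
   o(1 / L^2) of e^(i k (eta_star - eta)) / (16 pi^2 L^2) times the projection
   onto the cross-range plane: the near-field terms are O(1 / (kL)), the
   propagation directions are nearly vertical because a, b << L, and the
   difference of the two path lengths is (eta_star - eta) (1 + o(1)), where the
   o(1) costs only k h o(1) = o(1) of phase.  The disk has area pi a^2, so one
   frequency contributes a^2 / (16 pi L^2) e^(i k (eta_star - eta)) P p_star up
   to o(a^2 / L^2).  Integrating over the band gives the factor B when
   eta = eta_star, and otherwise an oscillating integral of size at most a
   constant times c / |eta - eta_star|.  All error terms are pointwise bounds on
   the integrands, so they pass through the integrals by monotonicity alone. *)

(** * Comparison of integrals under pointwise bounds *)

(* Unlike in the library version no measurability is required: the integral of
   a nonnegative function is a supremum over the simple functions below it. *)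
Lemma ge0_integral_le d (T : measurableType d) (R : realType)
    (mu : {measure set T -> \bar R})
  (D : set T) (f g : T -> \bar R) :
  (forall x, D x -> 0 <= f x)%E -> (forall x, D x -> f x <= g x)%E ->
  (\int[mu]_(x in D) f x <= \int[mu]_(x in D) g x)%E.
Proof.
move=> f0 fg.
have g0 x : D x -> (0 <= g x)%E by move=> Dx; exact: le_trans (f0 _ Dx) (fg _ Dx).
rewrite !ge0_integralE//; apply: le_ereal_sup => _ [h /= hf <-].
exists h => //= x.
apply: (le_trans (hf x)); rewrite /patch; case: ifPn => // /set_mem; exact: fg.
Qed.

(** The positive part grows with the function and the negative part shrinks, and extended
    subtraction is monotone in this sense even at infinite values. *)
Lemma integral_le d (T : measurableType d) (R : realType)
    (mu : {measure set T -> \bar R})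
  (D : set T) (f g : T -> \bar R) :
  (forall x, D x -> f x <= g x)%E ->
  (\int[mu]_(x in D) f x <= \int[mu]_(x in D) g x)%E.
Proof.
move=> fg; rewrite integralE [leRHS]integralE; apply: leeB.
- apply: ge0_integral_le => // x /mem_set; apply: funepos_le => y /set_mem; exact: fg.
- apply: ge0_integral_le => // x /mem_set; apply: funeneg_le => y /set_mem; exact: fg.
Qed.

Lemma integrable_cst d (T : measurableType d) (R : realType)
    (mu : {measure set T -> \bar R}) (D : set T) (V c : R) :
  measurable D -> mu D = V%:E -> mu.-integrable D (EFin \o cst c).
Proof.
move=> mD DV; apply: measurable_bounded_integrable => //; first by rewrite DV ltry.
by exists `|c|; split; [exact: num_real|move=> M cM x _ /=; exact: ltW].
Qed.

(** The integrals of g - e and g + e are finite and enclose that of f, so the latter is finite too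
    and the [fine] inside the real integral loses nothing. *)
Lemma Rintegral_near d (T : measurableType d) (R : realType)
    (mu : {measure set T -> \bar R})
  (D : set T) (f g : T -> R) (e V : R) :
  measurable D -> mu D = V%:E -> mu.-integrable D (EFin \o g) ->
  (forall x, D x -> `|f x - g x| <= e) ->
  `|\int[mu]_(x in D) f x - \int[mu]_(x in D) g x| <= e * V.
Proof.
move=> mD DV ig fg; have ie c := integrable_cst _ _ _ _ _ _ c mD DV.
have -> : V = fine (mu D) by rewrite DV.
have ige c : mu.-integrable D (EFin \o (fun x => g x + c)).
  have := integrableD mD ig (ie c); exact: eq_integrable.
have gE c : (\int[mu]_(x in D) (g x + c)%:E = (\int[mu]_(x in D) g x + c * fine (mu D))%:E)%E.
  rewrite -Rintegral_cst// -RintegralD//; [|exact: ie]; rewrite /Rintegral fineK//.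
  exact: (integrable_fin_num mD (ige c)).
have lo : ((\int[mu]_(x in D) g x + - e * fine (mu D))%:E <= \int[mu]_(x in D) (f x)%:E)%E.
  rewrite -gE; apply: integral_le => x Dx; rewrite lee_fin.
  by have := fg x Dx; rewrite ler_norml => /andP[]; lra.
have hi : (\int[mu]_(x in D) (f x)%:E <= (\int[mu]_(x in D) g x + e * fine (mu D))%:E)%E.
  rewrite -gE; apply: integral_le => x Dx; rewrite lee_fin.
  by have := fg x Dx; rewrite ler_norml => /andP[]; lra.
rewrite {1}/Rintegral.
case: (\int[mu]_(x in D) (f x)%:E)%E lo hi => [r| |]//=.
by rewrite !lee_fin => lo hi; rewrite ler_norml; apply/andP; split; lra.
Qed.

Lemma Rintegral_near_cst d (T : measurableType d) (R : realType)
    (mu : {measure set T -> \bar R}) (D : set T) (f : T -> R) (c e V : R) :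
  measurable D -> mu D = V%:E -> (forall x, D x -> `|f x - c| <= e) ->
  `|\int[mu]_(x in D) f x - c * V| <= e * V.
Proof.
move=> mD DV fc; have ic := integrable_cst _ _ _ _ _ _ c mD DV.
have := Rintegral_near _ _ _ mu D f (cst c) e V mD DV ic fc.
by rewrite Rintegral_cst// DV.
Qed.

(** * One-variable integrals: the frequency band, oscillating integrands, the semicircle *)

Section Real_integrals.
Context {R : realType}.
Local Notation leb := (@lebesgue_measure R).

Lemma continuous_is_derive (F f : R -> R) :
  (forall x : R, is_derive x (1 : R) F (f x)) -> continuous F.
Proof.
by move=> dF x; apply/differentiable_continuous/derivable1_diffP; have [] := dF x.
Qed.

Lemma is_derive_LRcontinuous (F f : R -> R) (a b : R) :
  (forall x : R, is_derive x (1 : R) F (f x)) -> derivable_oo_LRcontinuous F a b.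
Proof.
move=> dF; have cF := continuous_is_derive _ _ dF.
split=> [x _||]; first by have [] := dF x.
- exact/cvg_at_right_filter/cF.
- exact/cvg_at_left_filter/cF.
Qed.

Lemma integral_is_derive (F f : R -> R) (a b : R) : a < b ->
  (forall x : R, is_derive x (1 : R) F (f x)) -> continuous f ->
  (\int[leb]_(x in `[a, b]) (f x)%:E = (F b - F a)%:E)%E.
Proof.
move=> ab dF cf; rewrite (continuous_FTC2 ab (F := F)) //.
- exact: continuous_subspaceT.
- exact: is_derive_LRcontinuous.
- by move=> x _; rewrite derive1E; have [] := dF x.
Qed.

Lemma band_itvE (w0 B : R) :
  [set w : R | `|w - w0| < B / 2] = `]w0 - B / 2, w0 + B / 2[%classic.
Proof. by apply/seteqP; split=> w /=; rewrite in_itv/= ltr_distl. Qed.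

Lemma band_measure (w0 B : R) : 0 < B ->
  leb [set w : R | `|w - w0| < B / 2] = B%:E.
Proof.
move=> B0; rewrite band_itvE lebesgue_measure_itv/= lte_fin ifT; last by lra.
by rewrite -EFinD; congr EFin; field.
Qed.

Lemma integrable_itv (a b : R) (f : R -> R) : continuous f ->
  leb.-integrable `[a, b] (EFin \o f).
Proof.
move=> cf; apply: continuous_compact_integrable; first exact: segment_compact.
exact: continuous_subspaceT.
Qed.

Lemma integrable_band (w0 B : R) (f : R -> R) : continuous f ->
  leb.-integrable [set w : R | `|w - w0| < B / 2] (EFin \o f).
Proof.
move=> cf; rewrite band_itvE.
by apply: integrableS (integrable_itv _ _ _ cf) => //; exact: subset_itv_oo_cc.
Qed.

(** The endpoints are null; the closed interval is the form that the fundamental theorem of calculus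
    expects. *)
Lemma Rintegral_band (w0 B : R) (f : R -> R) : continuous f ->
  \int[leb]_(w in [set w | `|w - w0| < B / 2]) f w =
  \int[leb]_(w in `[w0 - B / 2, w0 + B / 2]) f w.
Proof.
move=> cf; rewrite band_itvE; have ifc := integrable_itv _ _ _ cf.
rewrite Rintegral_itv_bndo_bndc ?Rintegral_itv_obnd_cbnd //.
- by apply: integrableS (ifc _ _) => //; apply: subset_itvr; rewrite bnd_simp.
- by apply: integrableS (ifc _ _) => //; apply: subset_itv; rewrite bnd_simp.
Qed.

(** Common shape of the real and imaginary parts of e^(i s w) z, stable under differentiation and,
    for nonzero s, antidifferentiation in w. *)
Definition trig (a b s w : R) := a * cos (s * w) + b * sin (s * w).

Lemma is_derive_trig (a b s x : R) :
  is_derive x (1 : R) (trig a b s) (s * trig b (- a) s x).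
Proof.
by rewrite /trig; apply: trigger_derive; rewrite /GRing.scale/=; ring.
Qed.

Lemma continuous_trig (a b s : R) : continuous (trig a b s).
Proof. exact: continuous_is_derive (is_derive_trig a b s). Qed.

Lemma trigZ (r a b s w : R) : r * trig a b s w = trig (r * a) (r * b) s w.
Proof. by rewrite /trig; ring. Qed.

Lemma trig_le (a b s w : R) : `|trig a b s w| <= `|a| + `|b|.
Proof.
apply: (le_trans (ler_normD _ _)); rewrite !normrM lerD//.
- by rewrite ler_piMr// cos_max.
- by rewrite ler_piMr// sin_max.
Qed.

(** An antiderivative gains a factor 1 / s, so its two endpoint values, each at most (|a| + |b|) /
    |s|, bound the integral whatever the bandwidth. *)
Lemma Rintegral_trig_le (w0 B a b s : R) : 0 < B -> s != 0 ->
  `|\int[leb]_(w in [set w | `|w - w0| < B / 2]) trig a b s w|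
    <= 2 * (`|a| + `|b|) / `|s|.
Proof.
move=> B0 s0; rewrite Rintegral_band//; last exact: continuous_trig.
have dF x : is_derive x (1 : R) (trig (- (b / s)) (a / s) s) (trig a b s x).
  apply: (is_derive_eq (is_derive_trig _ _ _ _)).
  by rewrite opprK /trig; field.
rewrite /Rintegral (integral_is_derive _ _ _ _ _ dF)/=; last 2 first.
- lra.
- exact: continuous_trig.
apply: (le_trans (ler_normB _ _)).
apply: (le_trans (lerD (trig_le _ _ _ _) (trig_le _ _ _ _))).
rewrite normrN !normrM normfV le_eqVlt; apply/orP; left; apply/eqP; ring.
Qed.

(** [Num.sqrt] vanishes on negative numbers, so the integrand is the chord length of the disk,
    extended by 0 outside [-a, a]. *)
Lemma integral_semicircle (a : R) : 0 < a ->
  (\int[leb]_x (2 * Num.sqrt (a ^+ 2 - x ^+ 2))%:E = (pi * a ^+ 2)%:E)%E.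
Proof.
move=> a0.
have pi0 := pi_gt0 R.
pose G (x : R) : R := 2 * Num.sqrt (a ^+ 2 - x ^+ 2).
have cG : continuous G.
  move=> x; apply: cvgM; first exact: cvg_cst.
  apply: continuous_comp; last exact: sqrt_continuous.
  by apply: cvgB; [exact: cvg_cst|exact: exprn_continuous].
have G0 x : x \notin `[- a, a] -> G x = 0.
  rewrite in_itv/= -ler_norml -ltNge => ax; rewrite /G ler0_sqrtr ?mulr0//.
  by rewrite subr_le0 -[leRHS]real_normK ?num_real// ler_pXn2r ?nnegrE// ltW.
have -> : (\int[leb]_x (G x)%:E = \int[leb]_(x in `[(- a)%R, a]) (G x)%:E)%E.
  rewrite [RHS]integral_mkcond; apply: eq_integral => x _.
  rewrite /patch; case: ifPn => //; rewrite notin_setE => /negP; rewrite /= => xa.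
  by rewrite G0.
(* substitution x = a sin t *)
pose F t := a * sin t.
have dF x : is_derive x (1 : R) F (a * cos x).
  by apply: trigger_derive; rewrite /GRing.scale/=.
have F'E : F^`()%classic = fun x => a * cos x.
  by apply/funext => x; rewrite derive1E; have [] := dF x.
have cF' : continuous (fun x : R => a * cos x).
  by move=> x; apply: cvgM; [exact: cvg_cst|exact: continuous_cos].
have Fhi : F (pi / 2) = a by rewrite /F sin_pihalf mulr1.
have Flo : F (- (pi / 2)) = - a by rewrite /F sinN sin_pihalf mulrN1.
have -> : `[(- a)%R, a] = `[F (- (pi / 2)), F (pi / 2)] :> interval R.
  by rewrite Flo Fhi.
rewrite integration_by_substitution_increasing; last first.
- exact: continuous_subspaceT.
- exact: is_derive_LRcontinuous dF.
- by rewrite F'E; apply: cvgP; apply: cvg_at_left_filter; exact: cF'.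
- by rewrite F'E; apply: cvgP; apply: cvg_at_right_filter; exact: cF'.
- by rewrite F'E => x _; exact: cF'.
- by move=> x y xI yI xy; rewrite /F ltr_pM2l// ltr_sin.
- lra.
rewrite F'E.
have dH x : is_derive x (1 : R) (fun t => a ^+ 2 * (t + sin t * cos t)) (2 * (a * cos x) ^+ 2).
  apply: trigger_derive; rewrite /GRing.scale/=.
  transitivity (a ^+ 2 * (1 - sin x ^+ 2 + cos x ^+ 2)); first by ring.
  by rewrite sin2cos2; ring.
transitivity (\int[leb]_(x in `[(- (pi / 2))%R, (pi / 2)%R]) (2 * (a * cos x) ^+ 2)%:E)%E.
  apply: eq_integral => x; rewrite inE/= => xI; congr EFin.
  (* On this interval the cosine is nonnegative, so the square root of a^2 - (a sin t)^2 is a cos t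
     without absolute value. *)
  have cx : 0 <= cos x by apply: cos_ge0_pihalf; move: xI; rewrite in_itv.
  rewrite -[LHS]/(G (F x) * (a * cos x)).
  have -> : G (F x) = 2 * (a * cos x).
    rewrite /G/= /F; congr (_ * _).
    have acx : 0 <= a * cos x by rewrite mulr_ge0// ltW.
    rewrite -(ger0_norm acx) -sqrtr_sqr; congr Num.sqrt.
    by rewrite [RHS]exprMn cos2sin2; ring.
  by ring.
rewrite (integral_is_derive _ _ _ _ _ dH).
- by congr EFin; rewrite sinN cosN sin_pihalf cos_pihalf; field.
- lra.
- move=> x; apply: cvgM; first exact: cvg_cst.
  by apply: cvgM; exact: cF'.
Qed.

End Real_integrals.

(** * Measurability and area of the array *)

Section Disk.
Context {R : realType}.
Local Notation leb := (@lebesgue_measure R).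

Lemma diskP (a : R) (x : R * R) : 0 < a ->
  (norm2 x <= a) = (x.1 ^+ 2 + x.2 ^+ 2 <= a ^+ 2).
Proof.
move=> a0; rewrite -[in LHS](ger0_norm (ltW a0)) -sqrtr_sqr /norm2 ler_sqrt//.
exact: sqr_ge0.
Qed.

Lemma measurable_disk (a : R) : 0 < a ->
  measurable [set x : R * R | norm2 x <= a].
Proof.
move=> a0.
have -> : [set x : R * R | norm2 x <= a] =
    (fun x : R * R => x.1 ^+ 2 + x.2 ^+ 2) @^-1` `]-oo, a ^+ 2].
  by apply/seteqP; split=> x /=; rewrite in_itv/= diskP.
rewrite -[X in measurable X]setTI.
have mf : measurable_fun [set: R * R] (fun x : R * R => x.1 ^+ 2 + x.2 ^+ 2).
  by apply: measurable_funD; apply: measurable_funX; [exact: measurable_fst|exact: measurable_snd].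
exact: mf.
Qed.

(** The product measure integrates the lengths of the sections, which are the chords of
    [integral_semicircle]. *)
Lemma disk_area (a : R) : 0 < a ->
  (leb \x leb)%E [set x : R * R | norm2 x <= a] = (pi * a ^+ 2)%:E.
Proof.
move=> a0; rewrite -integral_semicircle// /product_measure1.
apply: eq_integral => x _ /=.
have [xa|xa] := lerP (x ^+ 2) (a ^+ 2).
  have -> : xsection [set x : R * R | norm2 x <= a] x =
      `[- Num.sqrt (a ^+ 2 - x ^+ 2), Num.sqrt (a ^+ 2 - x ^+ 2)]%classic.
    apply/seteqP; split=> y; rewrite /xsection/= inE/= diskP//= in_itv/= -ler_norml.
      by rewrite -lerBrDl -sqrtr_sqr ler_sqrt// subr_ge0.
    by rewrite -lerBrDl -sqrtr_sqr ler_sqrt// subr_ge0.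
  have := sqrtr_ge0 (a ^+ 2 - x ^+ 2).
  (* The measure formula for intervals tests a strict inequality of the endpoints, so the degenerate
     chord of length 0 is treated apart. *)
  rewrite lebesgue_measure_itv/= lte_fin le_eqVlt => /predU1P[<-|s0].
    by rewrite oppr0 ltxx mulr0.
  by rewrite ifT; [rewrite -EFinD; congr EFin; ring | lra].
have -> : xsection [set x : R * R | norm2 x <= a] x = set0.
  apply/seteqP; split=> y //; rewrite /xsection/= inE/= diskP//=.
  by have := sqr_ge0 y; lra.
by rewrite measure0 ler0_sqrtr ?mulr0// subr_le0 ltW.
Qed.

End Disk.

(** * Path lengths from the array to the imaging window *)

Section Geometry.
Context {R : realType}.
Implicit Types (L eps r z : R).

(* The distance from an array point to an image point at range z, the two being
   offset by (r1, r2) in the cross-range plane. *)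
Definition rad (r1 r2 z : R) : R := Num.sqrt (r1 ^+ 2 + r2 ^+ 2 + z ^+ 2).

(** The factor 2 accounts for a receiver and an image point that each lie within eps L of the axis;
    the bound 1 / 10 lets quadratic terms in eps be absorbed into linear ones. *)
Definition small_cross (eps L r1 r2 : R) :=
  [/\ 0 < L, 0 < eps, eps <= 1 / 10, `|r1| <= 2 * eps * L & `|r2| <= 2 * eps * L].

Lemma rad_sqr r1 r2 z : rad r1 r2 z ^+ 2 = r1 ^+ 2 + r2 ^+ 2 + z ^+ 2.
Proof. by rewrite sqr_sqrtr// !addr_ge0 ?sqr_ge0. Qed.

Lemma cross_sqr_le eps L r1 r2 : small_cross eps L r1 r2 ->
  r1 ^+ 2 + r2 ^+ 2 <= 8 * (eps * L) ^+ 2.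
Proof.
move=> [L0 eps0 eps1 hr1 hr2]; have eL : 0 <= 2 * eps * L by rewrite !mulr_ge0// ltW.
have sq t : `|t| <= 2 * eps * L -> t ^+ 2 <= 4 * (eps * L) ^+ 2.
  move=> ht; rewrite -[t ^+ 2]real_normK ?num_real//.
  have -> : 4 * (eps * L) ^+ 2 = (2 * eps * L) ^+ 2 by ring.
  by rewrite ler_sqr ?nnegrE.
by have := sq _ hr1; have := sq _ hr2; lra.
Qed.

(** For the upper bound, (z + 4 eps L)^2 exceeds z^2 by at least 16 (eps L)^2, while the cross-range
    part adds at most 8 (eps L)^2. *)
Lemma rad_bounds eps L r1 r2 z : small_cross eps L r1 r2 ->
  `|z - L| <= eps * L ->
  [/\ 9 / 10 * L <= z, z <= rad r1 r2 z, rad r1 r2 z <= z + 4 * eps * L & L / 2 <= rad r1 r2 z].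
Proof.
move=> cr; have [L0 eps0 eps1 hr1 hr2] := cr; rewrite ler_norml => /andP[z1 z2].
have eL : eps * L <= 1 / 10 * L by rewrite ler_pM2r.
have z0 : 9 / 10 * L <= z by lra.
have zr : z <= rad r1 r2 z.
  have {1}-> : z = Num.sqrt (z ^+ 2) by rewrite sqrtr_sqr ger0_norm//; lra.
  by rewrite /rad ler_wsqrtr// lerDr addr_ge0 ?sqr_ge0.
have eL0 : 0 < eps * L by rewrite mulr_gt0.
split => //; last by lra.
have w0 : 0 <= z + 4 * eps * L by lra.
rewrite -(ger0_norm w0) -sqrtr_sqr; apply: ler_wsqrtr.
have := cross_sqr_le _ _ _ _ cr; have : 0 <= eps * L * z by rewrite mulr_ge0; lra.
have : 0 <= (eps * L) ^+ 2 by rewrite sqr_ge0.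
by nra.
Qed.

Lemma rad_near eps L r1 r2 z : small_cross eps L r1 r2 ->
  `|z - L| <= eps * L -> `|rad r1 r2 z - L| <= 5 * eps * L.
Proof.
move=> cr zL; have [z0 zr rz _] := rad_bounds _ _ _ _ _ cr zL.
by move: zL; rewrite !ler_norml => /andP[? ?]; apply/andP; split; lra.
Qed.

(** Both radii are within 5 eps L of L, so L^2 differs from their product by at most 12.5 eps L^2,
    and that product is at least L^2 / 4. *)
Lemma rad_ratio eps L r1 r2 z1 z2 : small_cross eps L r1 r2 ->
  `|z1 - L| <= eps * L -> `|z2 - L| <= eps * L ->
  `|L ^+ 2 / (rad r1 r2 z1 * rad r1 r2 z2) - 1| <= 60 * eps.
Proof.
move=> cr h1 h2; have [L0 eps0 eps1 _ _] := cr.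
have [_ _ _ l1] := rad_bounds _ _ _ _ _ cr h1; have [_ _ _ l2] := rad_bounds _ _ _ _ _ cr h2.
have n1 := rad_near _ _ _ _ _ cr h1; have n2 := rad_near _ _ _ _ _ cr h2.
move: (rad r1 r2 z1) (rad r1 r2 z2) l1 l2 n1 n2 => u v l1 l2 n1 n2.
have u0 : 0 < u by lra. have v0 : 0 < v by lra.
have uv0 : 0 < u * v by rewrite mulr_gt0.
have -> : L ^+ 2 / (u * v) - 1 = (L ^+ 2 - u * v) / (u * v).
  by rewrite mulrBl divff// gt_eqF.
rewrite normrM normfV (gtr0_norm uv0) ler_pdivrMr//.
have -> : L ^+ 2 - u * v = - (L * (v - L) + (u - L) * L + (u - L) * (v - L)) by ring.
rewrite normrN; apply: (le_trans (ler_normD _ _)).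
apply: (le_trans (lerD (ler_normD _ _) (lexx _))); rewrite !normrM (gtr0_norm L0).
have p1 : `|u - L| * `|v - L| <= 5 * eps * L * (5 * eps * L) by rewrite ler_pM.
have p2 : L * `|v - L| <= L * (5 * eps * L) by rewrite ler_pM2l.
have p3 : `|u - L| * L <= 5 * eps * L * L by rewrite ler_pM2r.
have p4 : L / 2 * (L / 2) <= u * v by rewrite ler_pM//; lra.
have p5 : eps * (L / 2 * (L / 2)) <= eps * (u * v) by rewrite ler_pM2l.
have p6 : eps * (eps * L ^+ 2) <= 1 / 10 * (eps * L ^+ 2).
  by rewrite ler_pM2r// mulr_gt0// exprn_gt0.
nra.
Qed.

(* (u - v) (u + v) = (z1 - z2) (z1 + z2) turns the path difference into the
   range difference times (z1 + z2) / (u + v). *)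
Lemma rad_diff eps L r1 r2 z1 z2 : small_cross eps L r1 r2 ->
  `|z1 - L| <= eps * L -> `|z2 - L| <= eps * L ->
  `|(rad r1 r2 z1 - rad r1 r2 z2) - (z1 - z2)| <= 8 * eps * `|z1 - z2|.
Proof.
move=> cr h1 h2; have [L0 eps0 eps1 _ _] := cr.
have [a1 b1 c1 l1] := rad_bounds _ _ _ _ _ cr h1; have [a2 b2 c2 l2] := rad_bounds _ _ _ _ _ cr h2.
have := rad_sqr r1 r2 z1; have := rad_sqr r1 r2 z2.
move: (rad r1 r2 z1) (rad r1 r2 z2) b1 c1 l1 b2 c2 l2 => u v b1 c1 l1 b2 c2 l2 sv su.
have uv0 : 0 < u + v by lra.
have -> : (u - v) - (z1 - z2) = (z1 - z2) * ((z1 + z2 - (u + v)) / (u + v)).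
  have E : (u - v) * (u + v) = (z1 - z2) * (z1 + z2).
    by rewrite -!subr_sqr su sv; ring.
  apply: (mulIf (lt0r_neq0 uv0)).
  by rewrite -[RHS]mulrA divfK ?gt_eqF// mulrBl E; ring.
rewrite normrM mulrC ler_wpM2r// normrM normfV (gtr0_norm uv0) ler_pdivrMr//.
(* Each radius exceeds its range by at most 4 eps L, and u + v is at least L. *)
have p : 8 * eps * L <= 8 * eps * (u + v) by rewrite ler_pM2l ?mulr_gt0//; lra.
by apply: le_trans p; rewrite ler_norml; apply/andP; split; lra.
Qed.

End Geometry.

Import Normc.

(** * Complex moduli, the Hermitian norm and the cross-range projection *)

Section Complex_estimates.
Context {R : realType}.
Implicit Types (z w : R[i]) (t : R).

Lemma normc_complexR t : normc t%:C = `|t|.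
Proof. by rewrite /= expr0n/= addr0 sqrtr_sqr. Qed.

Lemma normc_ge0 z : 0 <= normc z.
Proof. by case: z => a b; exact: sqrtr_ge0. Qed.

Lemma normc_conj z : normc z^*%C = normc z.
Proof. by case: z => a b /=; rewrite sqrrN. Qed.

Lemma normc_Re_le z : `|complex.Re z| <= normc z.
Proof.
by case: z => a b /=; rewrite -sqrtr_sqr ler_wsqrtr// lerDl sqr_ge0.
Qed.

Lemma normc_Im_le z : `|complex.Im z| <= normc z.
Proof.
by case: z => a b /=; rewrite -sqrtr_sqr ler_wsqrtr// lerDr sqr_ge0.
Qed.

Lemma normc_le_ReIm z : normc z <= `|complex.Re z| + `|complex.Im z|.
Proof.
have -> : z = (complex.Re z)%:C + 'i%C * (complex.Im z)%:C by exact: complexE.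
apply: (le_trans (le_normcD _ _)).
by rewrite normcM !normc_complexR -complexE /= expr0n expr1n/= add0r sqrtr1 mul1r.
Qed.

Lemma normc_expi t : normc (expi t) = 1.
Proof. by rewrite /= cos2Dsin2 sqrtr1. Qed.

Lemma expiD (s t : R) : expi (s + t) = expi s * expi t.
Proof. by rewrite /expi cosD sinD; simpc; congr (_ +i* _); ring. Qed.

Lemma conj_expi t : (expi t)^*%C = expi (- t).
Proof. by rewrite /expi cosN sinN. Qed.

Lemma lipschitz1_is_derive (F f : R -> R) (s t : R) :
  (forall x : R, is_derive x (1 : R) F (f x)) -> (forall x, `|f x| <= 1) ->
  `|F s - F t| <= `|s - t|.
Proof.
move=> dF f1; wlog ts : s t / t <= s.
  move=> H; case: (leP t s) => [/H//|/ltW/H]; by rewrite distrC [leRHS]distrC.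
have cF : {within `[t, s], continuous F}.
  by apply: continuous_subspaceT; exact: (continuous_is_derive _ _ dF).
have [c _ ->] := MVT_segment ts (fun x _ => dF x) cF.
by rewrite normrM ler_piMl.
Qed.

Lemma expi_lipschitz (s t : R) : normc (expi s - expi t) <= 2 * `|s - t|.
Proof.
have cosL : `|cos s - cos t| <= `|s - t|.
  apply: (lipschitz1_is_derive _ _ _ _ (@is_derive_cos R)) => x.
  by rewrite normrN sin_max.
have sinL : `|sin s - sin t| <= `|s - t|.
  exact: (lipschitz1_is_derive _ _ _ _ (@is_derive_sin R) (@cos_max R)).
by apply: (le_trans (normc_le_ReIm _)); rewrite mulr_natl mulr2n lerD.
Qed.

Lemma normcB_le z w : normc (z - w) <= normc z + normc w.
Proof. by rewrite -[normc w]normcN; exact: le_normcD. Qed.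

(** The error of the first factor meets the actual second factor, of size at most B + e; the error
    of the second meets the reference value z0. *)
Lemma normcM_near (z w z0 w0 : R[i]) (d e A B : R) :
  normc (z - z0) <= d -> normc (w - w0) <= e -> normc z0 <= A -> normc w0 <= B ->
  normc (z * w - z0 * w0) <= d * (B + e) + A * e.
Proof.
move=> zd we z0A w0B.
have -> : z * w - z0 * w0 = (z - z0) * (w0 + (w - w0)) + z0 * (w - w0) by ring.
apply: (le_trans (le_normcD _ _)); rewrite !normcM lerD// ler_pM ?normc_ge0//.
by apply: (le_trans (le_normcD _ _)); rewrite lerD.
Qed.

Lemma normc_sum (I : finType) (f : I -> R[i]) :
  normc (\sum_i f i) <= \sum_i normc (f i).
Proof.
elim/big_ind2: _ => [|x1 x2 y1 y2 h1 h2|//]; first by rewrite normc0.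
by apply: (le_trans (le_normcD _ _)); rewrite lerD.
Qed.

Lemma normc_sum_near (n : nat) (f g : 'I_n -> R[i]) (e : R) :
  (forall i, normc (f i - g i) <= e) ->
  normc (\sum_i f i - \sum_i g i) <= n%:R * e.
Proof.
move=> fg; rewrite -sumrB; apply: (le_trans (normc_sum _ _)).
by apply: (le_trans (ler_sum _ (fun i _ => fg i))); rewrite sumr_const card_ord mulr_natl.
Qed.

Lemma cnormE n (v : 'cV[R[i]]_n) : cnorm v = Num.sqrt (\sum_i normc (v i 0) ^+ 2).
Proof.
congr Num.sqrt; apply: eq_bigr => i _.
by case: (v i 0) => a b /=; rewrite sqr_sqrtr// addr_ge0 ?sqr_ge0.
Qed.

Lemma cnorm_ge n (v : 'cV[R[i]]_n) i : normc (v i 0) <= cnorm v.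
Proof.
rewrite cnormE -[leLHS](ger0_norm (normc_ge0 _)) -sqrtr_sqr ler_wsqrtr//.
by rewrite (bigD1 i)//= lerDl sumr_ge0// => j _; exact: sqr_ge0.
Qed.

(** The factor 2 rounds up the square root of 3. *)
Lemma cnorm_le (v : 'cV[R[i]]_3) (e : R) :
  (forall i, normc (v i 0) <= e) -> cnorm v <= 2 * e.
Proof.
move=> ve; have e0 : 0 <= e := le_trans (normc_ge0 _) (ve 0).
have e20 : 0 <= 2 * e by rewrite mulr_ge0.
rewrite cnormE -[leRHS](ger0_norm e20) -sqrtr_sqr ler_wsqrtr//.
have le i : normc (v i 0) ^+ 2 <= e ^+ 2 by rewrite ler_sqr ?nnegrE ?normc_ge0.
apply: (le_trans (ler_sum _ (fun i _ => le i))); rewrite sumr_const card_ord.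
by have := sqr_ge0 e; rewrite -mulr_natr; nra.
Qed.

Lemma cross_projE (v : 'cV[R[i]]_3) i :
  (cross_proj *m v) i 0 = if (i < 2)%N then v i 0 else 0.
Proof.
rewrite mxE (bigD1 i)//= big1 ?addr0 => [|j ji].
  by rewrite mxE eqxx/=; case: ifP => _; rewrite ?mul1r ?mul0r.
by rewrite mxE eq_sym (negbTE ji) mul0r.
Qed.

(** The limits of the two dyads thereby multiply to a single projection. *)
Lemma cross_proj_idem (v : 'cV[R[i]]_3) :
  cross_proj *m (cross_proj *m v) = cross_proj *m v.
Proof. by apply/colP => i; rewrite !cross_projE; case: (i < 2)%N. Qed.

End Complex_estimates.

(** * Matrix factor of the Green function *)

Section Kernel_estimates.
Context {R : realType}.
Implicit Types (eps L : R) (x y : R * R).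

Lemma enorm_point3 x y (z : R) :
  enorm (point3 x 0 - point3 y z) = rad (x.1 - y.1) (x.2 - y.2) z.
Proof.
rewrite /enorm /rad !big_ord_recl big_ord0 !mxE/=; congr Num.sqrt.
by rewrite sub0r sqrrN addr0 addrA.
Qed.

Lemma entry_le_rad x y (z : R) (i : 'I_3) :
  `|(point3 x 0 - point3 y z) i 0| <= rad (x.1 - y.1) (x.2 - y.2) z.
Proof.
rewrite -enorm_point3 /enorm -sqrtr_sqr ler_wsqrtr// (bigD1 i)//= lerDl.
by rewrite sumr_ge0// => j _; exact: sqr_ge0.
Qed.

(** Propagation is nearly vertical: a cross-range entry is at most 2 eps L against a radius of at
    least L / 2, and the vertical-vertical entry misses 1 by the cross-range share of r^2, which is
    quadratic in eps. *)
Lemma direction_near eps L x y (z : R) (i j : 'I_3) :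
  small_cross eps L (x.1 - y.1) (x.2 - y.2) -> `|z - L| <= eps * L ->
  `|(point3 x 0 - point3 y z) i 0 * (point3 x 0 - point3 y z) j 0 /
      rad (x.1 - y.1) (x.2 - y.2) z ^+ 2
    - ((2 <= i)%N && (2 <= j)%N)%:R| <= 4 * eps.
Proof.
move=> cr zL; have [L0 eps0 eps1 hr1 hr2] := cr.
have [_ _ _ half] := rad_bounds _ _ _ _ _ cr zL.
have r0 : 0 < rad (x.1 - y.1) (x.2 - y.2) z by apply: lt_le_trans half; rewrite divr_gt0.
have rr0 : 0 < rad (x.1 - y.1) (x.2 - y.2) z ^+ 2 by rewrite exprn_gt0.
have cross_entry (l : 'I_3) : (l < 2)%N ->
    `|(point3 x 0 - point3 y z) l 0| <= 2 * eps * L.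
  by case: l => -[|[|[|//]]] //= ? _; rewrite !mxE/=.
have offdiag (l l' : 'I_3) : (l < 2)%N ->
    `|(point3 x 0 - point3 y z) l 0 * (point3 x 0 - point3 y z) l' 0 /
      rad (x.1 - y.1) (x.2 - y.2) z ^+ 2| <= 4 * eps.
  move=> l2; rewrite normrM normfV (gtr0_norm rr0) ler_pdivrMr// normrM.
  apply: (le_trans (ler_pM _ _ (cross_entry _ l2) (entry_le_rad x y z l'))) => //.
  rewrite expr2 mulrA ler_pM2r//.
  have : eps * (L / 2) <= eps * rad (x.1 - y.1) (x.2 - y.2) z by rewrite ler_pM2l.
  by lra.
case: (ltnP i 2) => [i2|i2]; first by rewrite subr0 offdiag.
case: (ltnP j 2) => [j2|j2]; first by rewrite subr0 [_ i 0 * _]mulrC offdiag.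
have ord2 (l : 'I_3) : (2 <= l)%N -> (point3 x 0 - point3 y z) l 0 = - z.
  by case: l => -[|[|[|//]]] //= ? _; rewrite !mxE/= sub0r.
rewrite !ord2//=.
have -> : - z * - z / rad (x.1 - y.1) (x.2 - y.2) z ^+ 2 - 1 =
    - ((x.1 - y.1) ^+ 2 + (x.2 - y.2) ^+ 2) / rad (x.1 - y.1) (x.2 - y.2) z ^+ 2.
  apply: (mulIf (lt0r_neq0 rr0)); rewrite mulrBl !divfK ?gt_eqF// mul1r rad_sqr.
  by ring.
rewrite normrM normfV (gtr0_norm rr0) ler_pdivrMr// normrN ger0_norm ?addr_ge0 ?sqr_ge0//.
apply: (le_trans (cross_sqr_le _ _ _ _ cr)).
have : (L / 2) ^+ 2 <= rad (x.1 - y.1) (x.2 - y.2) z ^+ 2.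
  by rewrite ler_sqr ?nnegrE// ltW// divr_gt0.
move=> h; have : eps * (L / 2) ^+ 2 <= eps * rad (x.1 - y.1) (x.2 - y.2) z ^+ 2 by rewrite ler_pM2l.
have : eps * (eps * L ^+ 2) <= 1 / 10 * (eps * L ^+ 2).
  by rewrite ler_pM2r// mulr_gt0// exprn_gt0.
have : 0 < eps * L ^+ 2 by rewrite mulr_gt0// exprn_gt0.
rewrite !exprMn; lra.
Qed.

(** The near-field term satisfies |m(s)| <= 1 / s + 1 / s^2, with 1 / s <= 2 eps. *)
Lemma dyadic_m_le eps (s : R) : 0 < eps -> eps <= 1 / 10 -> 1 <= 2 * eps * s ->
  normc (dyadic_m s) <= 4 * eps.
Proof.
move=> e0 e1 es; have s0 : 0 < s by rewrite -(pmulr_rgt0 s (_ : 0 < 2 * eps)); lra.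
have ss0 : 0 < s ^+ 2 by rewrite exprn_gt0.
rewrite /dyadic_m normcM normcV normc_complexR (gtr0_norm ss0) ler_pdivrMr//.
apply: (le_trans (normcB_le _ _)); rewrite normcM normc_complexR normc1 (gtr0_norm s0).
rewrite (_ : normc 'i = 1) ?mul1r; last by rewrite /= expr0n expr1n/= add0r sqrtr1.
nra.
Qed.

(** The bracket of [dyadic_green], separated from the scalar [green] because it tends to a constant
    real matrix while the scalar carries the phase. *)
Definition dyad x y (z k : R) : 'M[R[i]]_3 :=
  let r := point3 x 0 - point3 y z in
  (1 + dyadic_m (k * enorm r)) *: 1%:M -
  (1 + 3 * dyadic_m (k * enorm r)) *: mx_toC ((enorm r ^+ 2)^-1 *: (r *m r^T)).

(** The projection is the identity minus the vertical dyad. The error is 4 eps from m times the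
    identity, 4 eps from the direction and 12 eps from 3 m times the direction. *)
Lemma dyad_near eps L x y (z k : R) (i j : 'I_3) :
  small_cross eps L (x.1 - y.1) (x.2 - y.2) -> `|z - L| <= eps * L ->
  1 <= eps * (k * L) ->
  normc (dyad x y z k i j - cross_proj i j) <= 20 * eps.
Proof.
move=> cr zL kL; have [L0 eps0 eps1 hr1 hr2] := cr.
have [_ _ _ half] := rad_bounds _ _ _ _ _ cr zL.
have k0 : 0 < k by rewrite -(pmulr_lgt0 k L0) -(pmulr_rgt0 _ eps0); lra.
have dir := direction_near eps L x y z i j cr zL.
have r0 : 0 < rad (x.1 - y.1) (x.2 - y.2) z by apply: lt_le_trans half; rewrite divr_gt0.
have rr0 : 0 < rad (x.1 - y.1) (x.2 - y.2) z ^+ 2 by rewrite exprn_gt0.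
have dir1 : `|(point3 x 0 - point3 y z) i 0 * (point3 x 0 - point3 y z) j 0 /
      rad (x.1 - y.1) (x.2 - y.2) z ^+ 2| <= 1.
  rewrite normrM normfV (gtr0_norm rr0) ler_pdivrMr// normrM mul1r.
  by rewrite expr2 ler_pM// entry_le_rad.
have m4 : normc (dyadic_m (k * rad (x.1 - y.1) (x.2 - y.2) z)) <= 4 * eps.
  apply: dyadic_m_le => //; apply: (le_trans kL).
  have -> : 2 * eps * (k * rad (x.1 - y.1) (x.2 - y.2) z) =
    eps * (k * (2 * rad (x.1 - y.1) (x.2 - y.2) z)) by ring.
  by rewrite !ler_pM2l//; lra.
have -> : cross_proj i j = (i == j)%:R - (((2 <= i)%N && (2 <= j)%N)%:R : R)%:C :> R[i].
  rewrite /cross_proj mxE; case: i {dir dir1} => -[|[|[|//]]] hi; case: j => -[|[|[|//]]] hj //=;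
  by rewrite -?val_eqE/= ?subr0 ?subrr.
have -> : dyad x y z k i j =
   (1 + dyadic_m (k * rad (x.1 - y.1) (x.2 - y.2) z)) * (i == j)%:R
  - (1 + 3 * dyadic_m (k * rad (x.1 - y.1) (x.2 - y.2) z)) *
  ((point3 x 0 - point3 y z) i 0 * (point3 x 0 - point3 y z) j 0 /
      rad (x.1 - y.1) (x.2 - y.2) z ^+ 2)%:C.
  rewrite /dyad enorm_point3.
  move: (dyadic_m _) => m; move: (rad _ _ _) (point3 x 0 - point3 y z) => rd v.
  by rewrite /mx_toC !mxE big_ord1 !mxE; congr (_ - _ * _%:C); exact: mulrC.
move: (dyadic_m _) m4 dir dir1 => m m4.
move: (_ / _) => rho; move: (_ && _) => b dir dir1.
have -> : (1 + m) * (i == j)%:R - (1 + 3 * m) * rho%:C - ((i == j)%:R - (b%:R)%:C) =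
   m * (i == j)%:R - (rho - b%:R)%:C - 3 * (m * rho%:C).
  by rewrite rmorphB/=; ring.
have n3 : normc (3 : R[i]) = 3 by rewrite -[3]/(3%:R) -(rmorph_nat (real_complex R)) normc_complexR normr_nat.
apply: (le_trans (normcB_le _ _)); apply: (le_trans (lerD (normcB_le _ _) (lexx _))).
rewrite !normcM n3 !normc_complexR.
have a1 : normc m * normc (i == j)%:R <= 4 * eps * 1.
  by rewrite ler_pM ?normc_ge0//; case: (i == j); rewrite ?normc1 ?normc0.
have a2 : normc m * `|rho| <= 4 * eps * 1 by rewrite ler_pM ?normc_ge0.
lra.
Qed.

Lemma mulmx_near n (A A0 : 'M[R[i]]_n) (v v0 : 'cV[R[i]]_n) (d e B : R) i :
  (forall j, normc (A i j - A0 i j) <= d) -> (forall j, normc (A0 i j) <= 1) ->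
  (forall j, normc (v j 0 - v0 j 0) <= e) -> (forall j, normc (v0 j 0) <= B) ->
  normc ((A *m v) i 0 - (A0 *m v0) i 0) <= n%:R * (d * (B + e) + e).
Proof.
move=> hA hA0 hv hv0; rewrite !mxE; apply: normc_sum_near => j.
by rewrite -[X in _ <= _ + X]mul1r; exact: (normcM_near _ _ _ _ _ _ 1 B (hA j) (hv j) (hA0 j) (hv0 j)).
Qed.

Lemma cross_proj_le1 (i j : 'I_3) : normc (cross_proj i j : R[i]) <= 1.
Proof. by rewrite mxE; case: (_ && _); rewrite ?normc1 ?normc0. Qed.

Lemma mx_conj_cross_proj : mx_conj cross_proj = cross_proj :> 'M[R[i]]_3.
Proof. by apply/matrixP => i j; rewrite !mxE conjc_nat. Qed.

(** Two uses of [mulmx_near]: the inner product has error 60 eps Cp, the outer one 240 eps Cp + 3600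
    eps^2 Cp, whose last term is at most 60 eps Cp since eps is small. *)
Lemma dyad_product_near eps L x y (z1 z2 k Cp : R) (p : 'cV[R[i]]_3) i :
  small_cross eps L (x.1 - y.1) (x.2 - y.2) -> 300 * eps <= 1 ->
  `|z1 - L| <= eps * L -> `|z2 - L| <= eps * L -> 1 <= eps * (k * L) ->
  cnorm p <= Cp ->
  normc ((mx_conj (dyad x y z1 k) *m (dyad x y z2 k *m p)) i 0
         - (cross_proj *m p) i 0) <= 300 * eps * Cp.
Proof.
move=> cr e300 h1 h2 kL pC; have [L0 eps0 _ _ _] := cr.
have Cp0 : 0 <= Cp := le_trans (le_trans (normc_ge0 _) (cnorm_ge _ p 0)) pC.
have pCj j : normc (p j 0) <= Cp by exact: le_trans (cnorm_ge _ p j) pC.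
have Pp j : normc ((cross_proj *m p) j 0) <= Cp.
  by rewrite cross_projE; case: ifP; rewrite ?normc0.
have s1 j : normc ((dyad x y z2 k *m p) j 0 - (cross_proj *m p) j 0) <= 60 * eps * Cp.
  have pp l : normc (p l 0 - p l 0) <= 0 by rewrite subrr normc0.
  have := mulmx_near 3 (dyad x y z2 k) cross_proj p p (20 * eps) 0 Cp j
    (fun l => dyad_near eps L x y z2 k j l cr h2 kL) (cross_proj_le1 j) pp pCj.
  by move=> /le_trans; apply; rewrite le_eqVlt; apply/orP; left; apply/eqP; ring.
rewrite -[in X in _ - X]cross_proj_idem.
have conj_near j : normc (mx_conj (dyad x y z1 k) i j - cross_proj i j) <= 20 * eps.
  rewrite -mx_conj_cross_proj [X in X - _]mxE [X in _ - X]mxE -rmorphB normc_conj.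
  exact: (dyad_near eps L).
have := mulmx_near 3 (mx_conj (dyad x y z1 k)) cross_proj
    (dyad x y z2 k *m p) (cross_proj *m p) (20 * eps) (60 * eps * Cp) Cp i
    conj_near (cross_proj_le1 i) s1 Pp.
move=> /le_trans; apply.
have : 60 * eps * (eps * Cp) <= 1 * (eps * Cp) by rewrite ler_wpM2r ?mulr_ge0//; lra.
by nra.
Qed.

End Kernel_estimates.

(** * Scalar factor of the kernel and the full kernel estimate *)

Section Kirchhoff_kernel.
Context {R : realType}.
Implicit Types (eps L : R) (x y : R * R).

(** The Lipschitz bound turns the path error 8 eps |z2 - z1| into a phase error 16 K eps. As this is
    at most 1, the amplitude error 60 eps enters at most doubled. *)
Lemma phase_near eps L x y (z1 z2 k K : R) :
  small_cross eps L (x.1 - y.1) (x.2 - y.2) -> 16 * K * eps <= 1 ->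
  `|z1 - L| <= eps * L -> `|z2 - L| <= eps * L -> 0 < k ->
  k * `|z2 - z1| <= K ->
  normc ((L ^+ 2 / (rad (x.1 - y.1) (x.2 - y.2) z1 * rad (x.1 - y.1) (x.2 - y.2) z2))%:C
      * expi (k * (rad (x.1 - y.1) (x.2 - y.2) z2 - rad (x.1 - y.1) (x.2 - y.2) z1))
    - expi (k * (z2 - z1))) <= (120 + 16 * K) * eps.
Proof.
move=> cr K16 h1 h2 k0 kK; have [L0 eps0 _ _ _] := cr.
have ratio := rad_ratio _ _ _ _ _ _ cr h1 h2.
have diff := rad_diff _ _ _ _ _ _ cr h2 h1.
have phase : normc (expi (k * (rad (x.1 - y.1) (x.2 - y.2) z2 - rad (x.1 - y.1) (x.2 - y.2) z1))
   - expi (k * (z2 - z1))) <= 16 * K * eps.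
  apply: (le_trans (expi_lipschitz _ _)); rewrite -mulrBr normrM (gtr0_norm k0).
  have : k * `|rad (x.1 - y.1) (x.2 - y.2) z2 - rad (x.1 - y.1) (x.2 - y.2) z1 - (z2 - z1)|
     <= k * (8 * eps * `|z2 - z1|) by rewrite ler_pM2l.
  have : eps * (k * `|z2 - z1|) <= eps * K by rewrite ler_pM2l.
  by move=> ? ?; nra.
move: ratio phase; set rho := _ / _; move: (expi _) => E1 ratio phase.
have one : normc (rho%:C - 1 : R[i]) <= 60 * eps.
  by rewrite -(rmorph1 (real_complex R)) -rmorphB normc_complexR.
rewrite -[X in _ - X]mul1r.
apply: (le_trans (normcM_near _ _ _ _ _ _ 1 1 one phase _ _)).
- by rewrite normc1.
- by rewrite normc_expi.
have : eps * (16 * K * eps) <= eps * 1 by rewrite ler_pM2l.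
by move=> ?; nra.
Qed.

Lemma dyadic_green_dyad x y (z k : R) :
  dyadic_green (point3 x 0) (point3 y z) k =
  green (point3 x 0) (point3 y z) k *: dyad x y z k.
Proof. by []. Qed.

Lemma green_product L x y (z1 z2 k : R) :
  L != 0 ->
  (green (point3 x 0) (point3 y z1) k)^*%C * green (point3 x 0) (point3 y z2) k =
  ((16 * pi ^+ 2 * L ^+ 2)^-1)%:C *
   ((L ^+ 2 / (rad (x.1 - y.1) (x.2 - y.2) z1 * rad (x.1 - y.1) (x.2 - y.2) z2))%:C
      * expi (k * (rad (x.1 - y.1) (x.2 - y.2) z2 - rad (x.1 - y.1) (x.2 - y.2) z1))).
Proof.
move=> L0; rewrite /green !enorm_point3.
move: (rad _ _ z1) (rad _ _ z2) => r1 r2.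
have conjM (u v : R[i]) : (u * v)^*%C = u^*%C * v^*%C by exact: rmorphM.
rewrite conjM conj_expi -!fmorphV conjc_real mulrBr [k * r2 - _]addrC expiD.
transitivity (((4 * pi * r1)^-1 * (4 * pi * r2)^-1)%:C * (expi (- (k * r1)) * expi (k * r2))).
  by rewrite rmorphM; ring.
rewrite [RHS]mulrA -(rmorphM (real_complex R)); congr (_%:C * _).
have pi0 : pi != 0 :> R by rewrite gt_eqF ?pi_gt0.
(* A vanishing radius makes both sides 0, because the inverse of 0 is 0. *)
have [->|r10] := eqVneq r1 0; first by rewrite !(mulr0, mul0r, invr0).
have [->|r20] := eqVneq r2 0; first by rewrite !(mulr0, mul0r, invr0).
by move: pi pi0 => c c0; field; rewrite r10 r20 L0 c0.
Qed.

(** The phase and dyad errors add up to 2 (120 + 16 K) + 300 = 540 + 32 K, the factor 2 coming from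
    300 eps <= 1. *)
Lemma kernel_near eps L x y (z1 z2 k K Cp : R) (p : 'cV[R[i]]_3) i :
  small_cross eps L (x.1 - y.1) (x.2 - y.2) -> 300 * eps <= 1 -> 16 * K * eps <= 1 ->
  `|z1 - L| <= eps * L -> `|z2 - L| <= eps * L -> 1 <= eps * (k * L) ->
  k * `|z2 - z1| <= K -> cnorm p <= Cp ->
  normc ((mx_conj (dyadic_green (point3 x 0) (point3 y z1) k) *m
            (dyadic_green (point3 x 0) (point3 y z2) k *m p)) i 0
    - ((16 * pi ^+ 2 * L ^+ 2)^-1)%:C * (expi (k * (z2 - z1)) * (cross_proj *m p) i 0))
  <= (16 * pi ^+ 2 * L ^+ 2)^-1 * ((540 + 32 * K) * eps * Cp).
Proof.
move=> cr e300 K16 h1 h2 kL kK pC; have [L0 eps0 _ _ _] := cr.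
have k0 : 0 < k by rewrite -(pmulr_lgt0 k L0) -(pmulr_rgt0 _ eps0); lra.
have K0 : 0 <= K by apply: le_trans kK; rewrite mulr_ge0// ltW.
have Cp0 : 0 <= Cp := le_trans (le_trans (normc_ge0 _) (cnorm_ge _ p 0)) pC.
have c0 : 0 < (16 * pi ^+ 2 * L ^+ 2)^-1 :> R.
  by rewrite invr_gt0 !mulr_gt0 ?exprn_gt0 ?pi_gt0.
rewrite !dyadic_green_dyad.
have -> : (mx_conj (green (point3 x 0) (point3 y z1) k *: dyad x y z1 k) *m
   (green (point3 x 0) (point3 y z2) k *: dyad x y z2 k *m p)) i 0 =
   (green (point3 x 0) (point3 y z1) k)^*%C * green (point3 x 0) (point3 y z2) k *
   (mx_conj (dyad x y z1 k) *m (dyad x y z2 k *m p)) i 0.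
  have -> : forall g (M : 'M[R[i]]_3), mx_conj (g *: M) = g^*%C *: mx_conj M.
    by move=> g M; apply/matrixP => a b; rewrite !mxE rmorphM.
  by rewrite -scalemxAl -scalemxAl -scalemxAr scalerA mxE.
rewrite (green_product L) ?gt_eqF// -mulrA -mulrBr normcM normc_complexR (gtr0_norm c0) ler_pM2l//.
have Pp : normc ((cross_proj *m p) i 0) <= Cp.
  by rewrite cross_projE; case: ifP; rewrite ?normc0// => _; exact: le_trans (cnorm_ge _ p i) pC.
have th : normc (expi (k * (z2 - z1))) <= 1 by rewrite normc_expi.
have A := phase_near eps L x y z1 z2 k K cr K16 h1 h2 k0 kK.
have D := dyad_product_near eps L x y z1 z2 k Cp p i cr e300 h1 h2 kL pC.
apply: (le_trans (normcM_near _ _ _ _ _ _ 1 Cp A D th Pp)).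
have : 300 * eps * ((120 + 16 * K) * eps * Cp) <= 1 * ((120 + 16 * K) * eps * Cp).
  by rewrite ler_wpM2r// !mulr_ge0 ?addr_ge0 ?mulr_ge0// ltW.
by move=> ?; nra.
Qed.

End Kirchhoff_kernel.

(** * Integration of the kernel over the array and over the band *)

Section Image.
Context {R : realType}.
Local Notation leb := (@lebesgue_measure R).
Implicit Types (P : params R) (q : dipole R).

(** A boolean selects the real or the imaginary part, so that one real estimate serves both. *)
Definition part (b : bool) (z : R[i]) : R := if b then complex.Re z else complex.Im z.

Lemma part_le b (z : R[i]) : `|part b z| <= normc z.
Proof. by case: b; [exact: normc_Re_le|exact: normc_Im_le]. Qed.

Lemma normc_le_part (z : R[i]) (e : R) :
  (forall b, `|part b z| <= e) -> normc z <= 2 * e.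
Proof.
move=> ze; apply: (le_trans (normc_le_ReIm _)); rewrite mulr_natl mulr2n.
exact: lerD (ze true) (ze false).
Qed.

Lemma partB b (z w : R[i]) : part b (z - w) = part b z - part b w.
Proof. by case: b; case: z => ? ?; case: w. Qed.

Lemma partZ b (r : R) (z : R[i]) : part b (r%:C * z) = r * part b z.
Proof. by case: b; case: z => u v /=; simpc; rewrite /=; ring. Qed.

(* part b (i z): a quarter turn exchanges the real and imaginary parts. *)
Definition quarter b (z : R[i]) : R := if b then - complex.Im z else complex.Re z.

Lemma quarter_le b (z : R[i]) : `|quarter b z| <= normc z.
Proof. by case: b; rewrite /= ?normrN; [exact: normc_Im_le|exact: normc_Re_le]. Qed.

Lemma part_expi b (s w : R) (z : R[i]) :
  part b (expi (s * w) * z) = trig (part b z) (quarter b z) s w.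
Proof. by case: b; case: z => u v /=; rewrite /trig; ring. Qed.

Lemma part_cVintegral d (T : measurableType d) (mu : {measure set T -> \bar R}) n
    (D : set T) (f : T -> 'cV[R[i]]_n) i b :
  part b (cVintegral mu D f i 0) = \int[mu]_(x in D) part b (f x i 0).
Proof. by rewrite mxE; case: b. Qed.

(** Non-asymptotic form of the Fraunhofer regime: a single eps controls all small ratios, while K
    bounds the phase k |eta_star - eta| over the window, which is bounded but need not be small. *)
Definition regime (eps K : R) (Cb Ch : R) P :=
  [/\ admissible P, arrayr P <= eps * standoff P,
      `|Cb| * winx P <= eps * standoff P, `|Ch| * winz P <= eps * standoff P &
      forall w, closed_band P w ->
        1 <= eps * (wavenumber P w * standoff P) /\
        wavenumber P w * (2 * (`|Ch| * winz P)) <= K].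

(** The disk area pi a^2 times the kernel constant 1 / (16 pi^2 L^2). *)
Definition amplitude P : R := arrayr P ^+ 2 / (16 * pi * standoff P ^+ 2).

Definition image_point P q (eta : R) : 'cV[R]_3 :=
  point3 (crossr q) (standoff P + eta).

(** The phase k (eta_star - eta) is this rate times the angular frequency. *)
Definition range_rate P q (eta : R) : R := (roffset q - eta) / wspeed P.

Lemma coord_le_norm2 (x : R * R) : `|x.1| <= norm2 x /\ `|x.2| <= norm2 x.
Proof.
rewrite /norm2 -2!sqrtr_sqr; split; rewrite ler_wsqrtr//.
- by rewrite lerDl sqr_ge0.
- by rewrite lerDr sqr_ge0.
Qed.

(** [kernel_near] is uniform over the array, so integration multiplies value and error by the disk
    area; the factor mu w^2 of the data cancels against its inverse in [KM_freq]. *)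
Lemma KM_freq_near eps K Cb Ch Cp P q (eta w : R) i b :
  regime eps K Cb Ch P -> 0 < eps -> 300 * eps <= 1 -> 16 * K * eps <= 1 ->
  window_dipole Cb Ch Cp P q -> `|eta| <= Ch * winz P -> closed_band P w ->
  `|part b (KM_freq P q (image_point P q eta) w i 0) -
    amplitude P * trig (part b ((cross_proj *m polar q) i 0))
                       (quarter b ((cross_proj *m polar q) i 0))
                       (range_rate P q eta) w|
  <= amplitude P * ((540 + 32 * K) * eps * Cp).
Proof.
move=> [adm aL bL hL band] e0 e300 K16 [qb qh qC] etah bw.
have [kL kh] := band w bw.
have [c0 m0 b0 _ a0 L0 _ h0] := adm.
have w0 := b0 w bw.
have k0 : 0 < wavenumber P w by rewrite divr_gt0.
have mw0 : 0 < permea P * w ^+ 2 by rewrite mulr_gt0// exprn_gt0.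
have Chh : Ch * winz P <= `|Ch| * winz P by rewrite ler_pM2r// ler_norm.
have Cbb : Cb * winx P <= `|Cb| * winx P by rewrite ler_pM2r ?(winx_gt0 adm)// ler_norm.
have near1 : `|standoff P + eta - standoff P| <= eps * standoff P.
  by rewrite addrAC subrr add0r; lra.
have near2 : `|standoff P + roffset q - standoff P| <= eps * standoff P.
  by rewrite addrAC subrr add0r; lra.
have cr x : norm2 x <= arrayr P ->
    small_cross eps (standoff P) (x.1 - (crossr q).1) (x.2 - (crossr q).2).
  have [q1 q2] := coord_le_norm2 (crossr q).
  have [x1 x2] := coord_le_norm2 x => xa.
  split=> //; first lra.
  - by apply: (le_trans (ler_normB _ _)); lra.
  - by apply: (le_trans (ler_normB _ _)); lra.
have dk : wavenumber P w * `|standoff P + roffset q - (standoff P + eta)| <= K.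
  apply: le_trans kh; rewrite ler_pM2l// opprD addrACA subrr add0r.
  by apply: (le_trans (ler_normB _ _)); lra.
set v := (cross_proj *m polar q) i 0.
set c := (16 * pi ^+ 2 * standoff P ^+ 2)^-1 : R.
have cpos : 0 < c by rewrite invr_gt0 !mulr_gt0 ?exprn_gt0 ?pi_gt0.
have ker x (xa : norm2 x <= arrayr P) := kernel_near eps (standoff P) x (crossr q) _ _ _ K Cp (polar q) i
  (cr x xa) e300 K16 near1 near2 kL dk qC.
rewrite mxE partZ part_cVintegral.
pose g : R := permea P * w ^+ 2 * (c * trig (part b v) (quarter b v) (range_rate P q eta) w).
have close : forall x, receivers P x ->
  `|part b ((mx_conj (dyadic_green (point3 x 0) (image_point P q eta) (wavenumber P w)) *m
        array_data P q w x) i 0) - g|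
  <= permea P * w ^+ 2 * (c * ((540 + 32 * K) * eps * Cp)).
  move=> x xa; rewrite /array_data -scalemxAr mxE partZ -mulrBr normrM (gtr0_norm mw0) ler_pM2l//.
  rewrite -part_expi -partZ -partB.
  apply: (le_trans (part_le _ _)); apply: le_trans (ker x xa).
  rewrite /image_point /dipole_point (_ : range_rate P q eta * w =
    wavenumber P w * (standoff P + roffset q - (standoff P + eta)))//.
  by rewrite /range_rate /wavenumber; ring.
have mD : measurable (receivers P) := measurable_disk (arrayr P) a0.
have area : (leb \x leb)%E (receivers P) = (pi * arrayr P ^+ 2)%:E := disk_area (arrayr P) a0.
have := Rintegral_near_cst _ _ _ (leb \x leb)%E _ _ _ _ _ mD area close.
have -> : amplitude P = pi * arrayr P ^+ 2 * c.
  rewrite /amplitude /c; have := gt_eqF (pi_gt0 R); move: pi => p p0.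
  by field; rewrite p0 gt_eqF.
move: (\int[_]_(x in _) _) => X H.
rewrite -(ler_pM2l mw0) -{1}(gtr0_norm mw0) -normrM.
have -> : permea P * w ^+ 2 * ((permea P * w ^+ 2)^-1 * X -
   pi * arrayr P ^+ 2 * c * trig (part b v) (quarter b v) (range_rate P q eta) w) =
   X - g * (pi * arrayr P ^+ 2).
  by rewrite mulrBr mulVKf ?gt_eqF// /g; ring.
apply: (le_trans H); rewrite le_eqVlt; apply/orP; left; apply/eqP; ring.
Qed.

(** The single-frequency error is uniform over the band and therefore only picks up the factor B. *)
Lemma KM_near eps K Cb Ch Cp P q (eta : R) i b :
  regime eps K Cb Ch P -> 0 < eps -> 300 * eps <= 1 -> 16 * K * eps <= 1 ->
  window_dipole Cb Ch Cp P q -> `|eta| <= Ch * winz P ->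
  `|part b (KM P q (image_point P q eta) i 0) -
    \int[leb]_(w in [set w | `|w - cfreq P| < bandw P / 2])
      trig (amplitude P * part b ((cross_proj *m polar q) i 0))
           (amplitude P * quarter b ((cross_proj *m polar q) i 0))
           (range_rate P q eta) w|
  <= amplitude P * ((540 + 32 * K) * eps * Cp) * bandw P.
Proof.
move=> reg e0 e300 K16 wq etah; have [adm _ _ _ _] := reg.
have B0 := bandw_gt0 adm.
have BE := band_measure (cfreq P) _ B0.
rewrite part_cVintegral.
apply: Rintegral_near (BE) _ _ => //; first by rewrite band_itvE.
- by apply: integrable_band; exact: continuous_trig.
- move=> w wB; rewrite -trigZ; apply: (KM_freq_near _ _ _ _ _ _ _ _ _ _ _ reg e0 e300 K16 wq etah).
  by move: wB; rewrite /= /closed_band/= ltr_distl => /andP[? ?]; apply/andP; split; lra.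
Qed.

Lemma amplitude_gt0 P : admissible P -> 0 < amplitude P.
Proof.
by move=> [_ _ _ _ a0 L0 _ _]; rewrite divr_gt0 ?mulr_gt0 ?exprn_gt0 ?pi_gt0.
Qed.

Lemma amplitude_le P : admissible P -> amplitude P <= arrayr P ^+ 2 / standoff P ^+ 2.
Proof.
move=> [_ _ _ _ a0 L0 _ _]; rewrite ler_pM2l ?exprn_gt0//.
rewrite lef_pV2 ?posrE ?mulr_gt0 ?exprn_gt0 ?pi_gt0//.
by rewrite ler_pMl ?exprn_gt0//; have := pi_ge2 R; lra.
Qed.

Lemma cross_proj_entry_le (p : 'cV[R[i]]_3) (Cp : R) i :
  cnorm p <= Cp -> normc ((cross_proj *m p) i 0) <= Cp.
Proof.
move=> pC; rewrite cross_projE; case: ifP => _.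
  exact: le_trans (cnorm_ge _ p i) pC.
by rewrite normc0; apply: le_trans pC; exact: sqrtr_ge0.
Qed.

(** Each part of the main term is an oscillating integral of size at most 4 Cp c / |eta - eta_star|
    times [amplitude]. Passing to the complex modulus and then to the Hermitian norm doubles twice,
    whence the factors 16 and 4. *)
Lemma KM_offset_le eps K Cb Ch Cp P (u : dipole R * R) :
  regime eps K Cb Ch P -> 0 < eps -> 300 * eps <= 1 -> 16 * K * eps <= 1 ->
  window_offset Cb Ch Cp P u ->
  cnorm (KM P u.1 (image_point P u.1 u.2)) <=
  bandw P * (arrayr P ^+ 2 / standoff P ^+ 2) *
   (16 * Cp * (wspeed P / (bandw P * `|u.2 - roffset u.1|)) +
    4 * ((540 + 32 * K) * eps * Cp)).
Proof.
case: u => q eta /= reg e0 e300 K16 [/= wq etah neq]; have [adm _ _ _ band] := reg.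
have [_ _ qC] := wq.
have [c0 _ _ B0 _ _ _ _] := adm.
have A0 := amplitude_gt0 _ adm; have AL := amplitude_le _ adm.
have Cp0 : 0 <= Cp by apply: le_trans qC; exact: sqrtr_ge0.
(* The band contains its centre, where the bound on the phase forces K to be nonnegative. *)
have K0 : 0 <= K.
  have cb : closed_band P (cfreq P) by apply/andP; split; lra.
  have k0 : 0 < wavenumber P (cfreq P) by rewrite divr_gt0// (band_gt0 adm).
  have [_ h] := band _ cb; apply: le_trans h.
  have h0 := winz_gt0 adm.
  by rewrite (mulr_ge0 (ltW k0))// mulr_ge0// mulr_ge0// ltW.
have D0 : 0 < `|eta - roffset q| by rewrite normr_gt0 subr_eq0.
have s0 : range_rate P q eta != 0.
  by rewrite /range_rate mulf_neq0 ?invr_eq0 ?(gt_eqF c0)// subr_eq0 eq_sym.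
have main i b : `|part b (KM P q (image_point P q eta) i 0)| <=
    amplitude P * (4 * Cp * (wspeed P / `|eta - roffset q|)) +
    amplitude P * ((540 + 32 * K) * eps * Cp) * bandw P.
  have near := KM_near _ _ _ _ _ _ _ _ i b reg e0 e300 K16 wq etah.
  rewrite -[X in `|X|](subrK (\int[leb]_(w in [set w | `|w - cfreq P| < bandw P / 2])
      trig (amplitude P * part b ((cross_proj *m polar q) i 0))
           (amplitude P * quarter b ((cross_proj *m polar q) i 0))
           (range_rate P q eta) w)).
  apply: (le_trans (ler_normD _ _)); rewrite addrC lerD//.
  apply: (le_trans (Rintegral_trig_le _ _ _ _ _ B0 s0)).
  have -> : `|range_rate P q eta|^-1 = wspeed P / `|eta - roffset q|.
    by rewrite /range_rate normrM normfV (gtr0_norm c0) distrC invf_div.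
  have v := cross_proj_entry_le _ _ i qC.
  have scaled (g : R[i] -> R) : (forall z, `|g z| <= normc z) ->
      `|amplitude P * g ((cross_proj *m polar q) i 0)| <= amplitude P * Cp.
    by move=> gle; rewrite normrM (gtr0_norm A0) ler_pM2l// (le_trans (gle _) v).
  have r0 : 0 <= wspeed P / `|eta - roffset q| by rewrite divr_ge0// ltW.
  have -> : amplitude P * (4 * Cp * (wspeed P / `|eta - roffset q|)) =
    2 * (amplitude P * Cp + amplitude P * Cp) * (wspeed P / `|eta - roffset q|) by ring.
  rewrite ler_wpM2r// ler_pM2l// lerD//; apply: scaled.
    exact: part_le.
  exact: quarter_le.
apply: (le_trans (cnorm_le _ _ (fun i => normc_le_part _ _ (main i)))).
rewrite [(bandw P * _)^-1]invfM.
have -> : 2 * (2 * (amplitude P * (4 * Cp * (wspeed P / `|eta - roffset q|)) +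
    amplitude P * ((540 + 32 * K) * eps * Cp) * bandw P)) =
  bandw P * (amplitude P * (16 * Cp * (wspeed P * ((bandw P)^-1 * `|eta - roffset q|^-1)) +
    4 * ((540 + 32 * K) * eps * Cp))).
  by field; rewrite !gt_eqF.
have e1 : 0 <= 16 * Cp * (wspeed P * ((bandw P)^-1 * `|eta - roffset q|^-1)).
  by rewrite !mulr_ge0 ?invr_ge0// ltW.
have e0K : 0 <= (540 + 32 * K) * eps.
  exact: mulr_ge0 (addr_ge0 (ler0n _ 540) (mulr_ge0 (ler0n _ 32) K0)) (ltW e0).
have e2 : 0 <= 4 * ((540 + 32 * K) * eps * Cp).
  exact: mulr_ge0 (ler0n _ 4) (mulr_ge0 e0K Cp0).
rewrite -[leRHS]mulrA (ler_pM2l B0).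
exact: ler_wpM2r (addr_ge0 e1 e2) _ _ AL.
Qed.

(** At the dipole the rate vanishes, so the approximating integrand is constant and integrates to B
    times its value. *)
Lemma KM_dipole_near eps K Cb Ch Cp P q :
  regime eps K Cb Ch P -> 0 < eps -> 300 * eps <= 1 -> 16 * K * eps <= 1 ->
  window_dipole Cb Ch Cp P q ->
  forall i, normc (KM P q (dipole_point P q) i 0 -
    (bandw P)%:C * ((amplitude P)%:C * (cross_proj *m polar q) i 0)) <=
    2 * (amplitude P * ((540 + 32 * K) * eps * Cp) * bandw P).
Proof.
move=> reg e0 e300 K16 wq i; have [adm _ _ _ _] := reg; have B0 := bandw_gt0 adm.
have [_ etah _] := wq.
apply: normc_le_part => b.
have := KM_near _ _ _ _ _ _ _ _ i b reg e0 e300 K16 wq etah.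
rewrite /range_rate subrr mul0r partB !partZ.
under eq_Rintegral do rewrite /trig mul0r cos0 sin0 mulr1 mulr0 addr0.
rewrite Rintegral_cst; last by rewrite band_itvE.
have -> : fine (leb [set w | `|w - cfreq P| < bandw P / 2]) = bandw P.
  exact: (congr1 fine (band_measure (cfreq P) (bandw P) B0)).
by rewrite [_ * bandw P in X in `|_ - X|]mulrC.
Qed.

End Image.

(** * From the asymptotic regime to explicit inequalities *)

Section Fraunhofer_regime.
Context {R : realType} {T : Type}.

(** The ratios a / L, b / L, h / L are taken below eps / (|C| + 1), where C is the relevant constant
    and the 1 avoids division by 0. K comes from the bound on k h alone, so it is fixed before
    eps. *)
Lemma near_regime (F : set_system T) (FF : ProperFilter F) (P : T -> params R)
    (Cb Ch : R) : fraunhofer F P ->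
  exists K : R, forall eps : R, 0 < eps -> \forall t \near F, regime eps K Cb Ch (P t).
Proof.
move=> hP; have adm := fraunhofer_adm hP.
have [M kh] := fraunhofer_kh hP.
exists (2 * `|Ch| * M) => eps eps0.
have scale_le (X Y C : R) : 0 < X -> 0 < Y ->
    `|X / Y| <= eps / (`|C| + 1) * `|1| -> `|C| * X <= eps * Y.
  move=> X0 Y0; have C1 : 0 < `|C| + 1 by rewrite ltr_pwDr.
  rewrite normr1 mulr1 gtr0_norm ?divr_gt0// ler_pdivrMr// mulrAC ler_pdivlMr//.
  by move=> h; apply: le_trans h; rewrite mulrDr mulr1 mulrC lerDl ltW.
have eps_pos (C : R) : 0 < eps / (`|C| + 1) by rewrite divr_gt0// ltr_pwDr.
have hk := fraunhofer_kL hP eps0.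
have ha := fraunhofer_a hP (eps_pos 1).
have hb := fraunhofer_b hP (eps_pos Cb).
have hh := fraunhofer_h hP (eps_pos Ch).
apply: filterS (filterI kh (filterI hk (filterI ha (filterI hb hh)))).
move=> t [kht [hkt [hat [hbt hht]]]].
have admt := adm t.
have [c0 _ b0 B0 a0 L0 x0 z0] := admt.
(* Comparisons free of the frequency are still quantified over the band, so they are read off at its
   centre. *)
have cb : closed_band (P t) (cfreq (P t)) by apply/andP; split; lra.
split=> //.
- by have := scale_le _ _ 1 a0 L0 (hat _ cb); rewrite normr1 mul1r.
- exact: scale_le (hbt _ cb).
- exact: scale_le (hht _ cb).
- move=> w wb; have k0 : 0 < wavenumber (P t) w by rewrite divr_gt0// b0.
  have kL0 : 0 < wavenumber (P t) w * standoff (P t) by rewrite mulr_gt0.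
  split.
    have := hkt w wb; rewrite normr1 mulr1 gtr0_norm ?divr_gt0//.
    by rewrite ler_pdivrMr.
  have := kht w wb; rewrite normr1 mulr1 => /(le_trans (ler_norm _)) h.
  have -> : wavenumber (P t) w * (2 * (`|Ch| * winz (P t))) =
    2 * `|Ch| * (wavenumber (P t) w * winz (P t)) by ring.
  by rewrite ler_wpM2l// mulr_ge0.
Qed.

Lemma small_eps (K Cp e : R) : 0 < e ->
  exists eps : R, [/\ 0 < eps, 300 * eps <= 1, 16 * K * eps <= 1 &
    4 * ((540 + 32 * K) * eps * Cp) <= e].
Proof.
move=> e0; pose X := 4 * (540 + 32 * K) * Cp.
(* The inverse of D serves as eps; each summand secures one of the three upper bounds. *)
pose D := 300 + `|16 * K| + `|X| / e.
have Xe : 0 <= `|X| / e by rewrite divr_ge0// ltW.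
have D0 : 0 < D by rewrite /D -addrA ltr_pwDl// addr_ge0.
have bound (u : R) : u <= D -> u * D^-1 <= 1 by move=> uD; rewrite ler_pdivrMr// mul1r.
exists D^-1; split; first by rewrite invr_gt0.
- by apply: bound; rewrite /D -addrA lerDl addr_ge0.
- apply: bound; apply: (le_trans (ler_norm _)).
  by rewrite /D addrAC lerDr addr_ge0.
- have -> : 4 * ((540 + 32 * K) * D^-1 * Cp) = X / e * D^-1 * e.
    by rewrite [RHS]mulrAC divfK ?gt_eqF// /X; ring.
  rewrite -[leRHS]mul1r ler_pM2r//; apply: bound.
  apply: (@le_trans _ _ (`|X| / e)); first by rewrite ler_pM2r ?invr_gt0// ler_norm.
  by rewrite /D lerDr addr_ge0.
Qed.

End Fraunhofer_regime.

(** * Landau form of the explicit bounds, away from the dipole and at it *)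

Theorem proposition2p4 (R : realType) (T : Type) (F : set_system T)
    (FF : ProperFilter F) (P : T -> params R) (hP : fraunhofer F P)
    (Cb Ch Cp : R) :
  (exists f g : T -> dipole R * R -> R,
    [/\ unif_bigO F (fun t => window_offset Cb Ch Cp (P t)) f
          (fun t u => wspeed (P t) / (bandw (P t) * `|u.2 - roffset u.1|)),
        unif_littleo F (fun t => window_offset Cb Ch Cp (P t)) g
          (fun _ _ => 1) &
        forall t u, window_offset Cb Ch Cp (P t) u ->
          cnorm (KM (P t) u.1 (point3 (crossr u.1) (standoff (P t) + u.2))) =
          bandw (P t) * (arrayr (P t) ^+ 2 / standoff (P t) ^+ 2) *
            (f t u + g t u)]) /\
  (exists rho : T -> dipole R -> 'cV[R[i]]_3,
    unif_littleo F (fun t => window_dipole Cb Ch Cp (P t))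
      (fun t q => cnorm (rho t q))
      (fun t _ => arrayr (P t) ^+ 2 / standoff (P t) ^+ 2) /\
    forall t q, window_dipole Cb Ch Cp (P t) q ->
      KM (P t) q (dipole_point (P t) q) =
      (bandw (P t))%:C *:
        ((arrayr (P t) ^+ 2 / (16 * pi * standoff (P t) ^+ 2))%:C *:
           (cross_proj *m polar q) + rho t q)).
Proof.
have adm t := fraunhofer_adm hP t.
have [K regK] := near_regime F FF P Cb Ch hP.
split.
  pose X t (u : dipole R * R) := wspeed (P t) / (bandw (P t) * `|u.2 - roffset u.1|).
  pose D t := bandw (P t) * (arrayr (P t) ^+ 2 / standoff (P t) ^+ 2).
  pose N t u :=
    cnorm (KM (P t) u.1 (point3 (crossr u.1) (standoff (P t) + u.2))) / D t.
  (* N <= M X + o(1) splits as min(N, M X) plus a remainder in [0, o(1)]. *)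
  pose f t u := Num.min (N t u) (16 * `|Cp| * X t u).
  have D0 t : 0 < D t.
    by have [_ _ _ B0 a0 L0 _ _] := adm t; rewrite mulr_gt0 ?divr_gt0 ?exprn_gt0.
  have N0 t u : 0 <= N t u by rewrite divr_ge0 ?sqrtr_ge0// ltW.
  have X0 t u : 0 <= X t u.
    have [c0 _ _ B0 _ _ _ _] := adm t.
    exact: divr_ge0 (ltW c0) (mulr_ge0 (ltW B0) (normr_ge0 _)).
  exists f, (fun t u => N t u - f t u); split.
  - exists (16 * `|Cp|); apply: nearW => t u _.
    rewrite [X in _ <= _ * X]ger0_norm ?X0// ger0_norm.
      by rewrite /f ge_min lexx orbT.
    by rewrite /f le_min N0 mulr_ge0.
  - move=> e e0; have [eps [eps0 e300 K16 small]] := small_eps K Cp e e0.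
    apply: filterS (regK eps eps0) => t reg u wu.
    have h := KM_offset_le _ _ _ _ _ _ _ reg eps0 e300 K16 wu.
    have Nle : N t u <= 16 * Cp * X t u + 4 * ((540 + 32 * K) * eps * Cp).
      by rewrite /N ler_pdivrMr// mulrC.
    have CX : 16 * Cp * X t u <= 16 * `|Cp| * X t u.
      by apply: ler_wpM2r => //; rewrite ler_pM2l// ler_norm.
    rewrite normr1 mulr1 ger0_norm /f ?subr_ge0 ?ge_min ?lexx//.
    (* Either the minimum is N and the remainder is 0, or it is the multiple of X and [Nle] leaves
       only the small term. *)
    rewrite lerBlDl minEle; case: ifP => _; first by rewrite lerDl ltW.
    by apply: (le_trans Nle); exact: lerD.
  - by move=> t u _; rewrite [f t u + _]addrC subrK -/(D t) mulrC divfK ?gt_eqF.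
pose main t q : 'cV[R[i]]_3 := (amplitude (P t))%:C *: (cross_proj *m polar q).
(* The remainder is defined by solving the required equation, so only its size is left to
   estimate. *)
exists (fun t q => ((bandw (P t))^-1)%:C *: KM (P t) q (dipole_point (P t) q) - main t q).
split; last first.
  move=> t q _; rewrite -[X in _ *: (X + _)]/(main t q) [main t q + _]addrC subrK.
  rewrite scalerA -(rmorphM (real_complex R)) divff ?scale1r//.
  by rewrite gt_eqF// (bandw_gt0 (adm t)).
move=> e e0; have [eps [eps0 e300 K16 small]] := small_eps K Cp e e0.
apply: filterS (regK eps eps0) => t reg q wq.
have B0 := bandw_gt0 (adm t).
have A0 := amplitude_gt0 _ (adm t); have AL := amplitude_le _ (adm t).
have near := KM_dipole_near _ _ _ _ _ _ _ reg eps0 e300 K16 wq.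
rewrite [X in _ <= _ * X]ger0_norm; last exact: le_trans (ltW A0) AL.
rewrite ger0_norm ?sqrtr_ge0//.
apply: (@le_trans _ _ (2 * (2 * (amplitude (P t) * ((540 + 32 * K) * eps * Cp))))).
  apply: cnorm_le => i.
  have -> : (((bandw (P t))^-1)%:C *: KM (P t) q (dipole_point (P t) q) - main t q) i 0 =
      ((bandw (P t))^-1)%:C * (KM (P t) q (dipole_point (P t) q) i 0 -
        (bandw (P t))%:C * ((amplitude (P t))%:C * (cross_proj *m polar q) i 0)).
    rewrite mulrBr [X in _ = _ - X]mulrA -(rmorphM (real_complex R)) mulVf ?gt_eqF// mul1r.
    by rewrite /main !mxE.
  rewrite normcM normc_complexR gtr0_norm ?invr_gt0// ler_pdivrMl//.
  by apply: (le_trans (near i)); rewrite le_eqVlt; apply/orP; left; apply/eqP; ring.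
have -> : 2 * (2 * (amplitude (P t) * ((540 + 32 * K) * eps * Cp))) =
  amplitude (P t) * (4 * ((540 + 32 * K) * eps * Cp)) by ring.
rewrite [leRHS]mulrC.
by apply: (le_trans (ler_wpM2l (ltW A0) small)); rewrite ler_pM2r.
Qed.
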